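(* For $1$-regular inputs with vanishing edge values, the greedy CRS is $\frac12$-selectable when the edges arrive in a uniformly random order: for every sequence of $1$-regular inputs $(G(n),\boldsymbol{x}(n))$ with vanishing edge values there are $c_n\to\frac12$ such that, for every edge $e$ of $G(n)$, $\Pr[e\in\mathcal{M}\mid X_e=1]\ge c_n$.
   Context: An input $(G,\boldsymbol{x})$ is a finite simple graph $G=(V,E)$ with $x_e\in[0,1]$; it is $1$-regular if $\sum_{e\in\partial(v)}x_e=1$ for every $v\in V$. Each edge is independently active ($X_e=1$) with probability $x_e$. A sequence of inputs has vanishing edge values if there are $\varepsilon(n)\to0$ with $x_e(n)\le\varepsilon(n)$ for all edges. The greedy CRS processes the edges in the given order and adds an arriving edge to the matching $\mathcal{M}$ whenever it is active and both its endpoints are unmatched. In uniformly random order, the order is a uniformly random permutation of $E$, independent of the states. *)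

(* Defs.v *)
From HB Require Import structures.
From mathcomp Require Import all_boot all_order all_algebra all_fingroup.
From mathcomp Require Import all_classical all_reals all_analysis.
Set Implicit Arguments.
Unset Strict Implicit.
Unset Printing Implicit Defensive.
Import Order.TTheory GRing.Theory Num.Theory.
Import numFieldNormedType.Exports.
Local Open Scope ring_scope.

Record sgraph := SGraph {
  vertex : finType;
  edges : {set {set vertex}};
  edges_card2 : forall e, e \in edges -> #|e| = 2%N
}.

Definition edge (G : sgraph) : finType := {e : {set vertex G} | e \in edges G}.

Definition incident (G : sgraph) (v : vertex G) (e : edge G) : bool :=
  v \in val e.

Record input (R : realType) := Input {
  graph : sgraph;
  xval : edge graph -> R;
  xval_ge0 : forall e, 0 <= xval e;
  xval_le1 : forall e, xval e <= 1
}.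

Definition one_regular (R : realType) (I : input R) : Prop :=
  forall v : vertex (graph I), \sum_(e | incident v e) xval e = 1.

Definition vanishing_edge_values (R : realType) (I : nat -> input R) : Prop :=
  exists eps : nat -> R, (eps @ \oo --> (0 : R))%classic /\
    forall n (e : edge (graph (I n))), xval e <= eps n.

Section Greedy.
Variable G : sgraph.

Definition matched (M : {set edge G}) (v : vertex G) : bool :=
  [exists f in M, incident v f].

Definition greedy_step (X : {ffun edge G -> bool}) (M : {set edge G})
    (e : edge G) : {set edge G} :=
  if X e && [forall (v | incident v e), ~~ matched M v] then e |: M else M.

Definition greedy (X : {ffun edge G -> bool}) (s : seq (edge G)) :
    {set edge G} :=
  foldl (greedy_step X) finset.set0 s.

(* The k-th arriving edge is the image under [p] of the k-th edge of the fixed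
   enumeration of the edges; a uniform [p] gives a uniform arrival order. *)
Definition arrival (p : {perm edge G}) : seq (edge G) :=
  [seq p e | e <- enum (edge G)].

End Greedy.

Section Probability.
Variables (R : realType) (I : input R).
Let E : finType := edge (graph I).

(* Outcomes: the states of the edges together with the arrival permutation. *)
Definition outcome : finType := ({ffun E -> bool} * {perm E})%type.

(* Independent edge states, independent of a uniform permutation. *)
Definition pmf (w : outcome) : R :=
  (\prod_(e : E) (if w.1 e then xval e else 1 - xval e)) / #|{perm E}|%:R.

Definition Pr (A : {set outcome}) : R := \sum_(w in A) pmf w.

Definition cPr (A B : {set outcome}) : R := Pr (A :&: B) / Pr B.

Definition active (e : E) : {set outcome} :=
  finset.finset (fun w : outcome => w.1 e).

Definition selected (e : E) : {set outcome} :=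
  finset.finset (fun w : outcome => e \in greedy w.1 (arrival w.2)).

(* Conditioning on [active e] makes sense only when it has positive
   probability, that is when [xval e] is nonzero. *)
Definition random_order_greedy_selectable (c : R) : Prop :=
  forall e : E, 0 < xval e -> c <= cPr (selected e) (active e).

End Probability.

(* Main.v *)
(* Let P(S, t) be the probability that all vertices of S are unmatched at time
   t. The edge arriving at time t spoils this exactly when it is active, touches
   S, and finds S together with its own endpoints unmatched, so dP(S, t)/dt is
   minus the sum of x_f P(S + f, t) over the edges f touching S, where on the
   right f is deleted from the graph. For a 1-regular input with edge values at
   most eps, the edges leaving S have total weight |S| - O(eps), whence up to
   O(eps) this is the hierarchy (h^k)' = - k h^(k+1) solved by h = 1/(1+t).
   Unfolding it r times starting from the two endpoints of e leaves a remainder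
   (r+1) t^r, which vanishes for t < 1. Hence an active edge e is selected with
   probability close to the integral of h^2 over [0,1], which is 1/2.
   Time is discretised as the number of arrivals. *)

Require Import Defs.
From HB Require Import structures.
From mathcomp Require Import all_boot all_order all_algebra all_fingroup.
From mathcomp Require Import all_classical all_reals all_analysis.
From mathcomp Require Import ring lra zify.
Import Order.TTheory GRing.Theory Num.Theory.
Import numFieldNormedType.Exports.
Local Open Scope ring_scope.
Set Implicit Arguments.
Unset Strict Implicit.
Unset Printing Implicit Defensive.

(** * Averages over ordered samples drawn without replacement *)

Section OrderedSamples.
Variables (R : realType) (T : finType).
Implicit Types (A : {set T}) (F : seq T -> R).

(* The mean of [F] over the orderings of a uniform [j]-element subset of [A];
   the last element is drawn first, since the recursions below split it off. *)
Fixpoint avg (j : nat) A F : R :=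
  if j is i.+1 then
    #|A|%:R^-1 * \sum_(f in A) avg i (A :\ f) (fun s => F (rcons s f))
  else F [::].

Lemma card_neq0 A : (0 < #|A|)%N -> #|A|%:R != 0 :> R.
Proof. by rewrite pnatr_eq0 lt0n. Qed.

Lemma cardsD1_pred A f : f \in A -> #|A :\ f| = #|A|.-1.
Proof. by move=> fA; rewrite (cardsD1 f A) fA. Qed.

Lemma eq_avg j A F G :
  (forall s, {subset s <= A} -> F s = G s) -> avg j A F = avg j A G.
Proof.
elim: j A F G => [|j IH] A F G FG; first by rewrite /= FG.
congr (_ * _); apply: eq_bigr => f fA; apply: IH => s sA; apply: FG => x.
rewrite mem_rcons inE => /orP[/eqP->//|/sA]; rewrite !inE.
by case/andP.
Qed.

Lemma avgB j A F G : avg j A (fun s => F s - G s) = avg j A F - avg j A G.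
Proof.
elim: j A F G => [|j IH] A F G //=.
rewrite -[RHS]mulrBr -[in RHS]sumrB; congr (_ * _).
by apply: eq_bigr => f _; rewrite IH.
Qed.

Lemma avgZ j A c F : avg j A (fun s => c * F s) = c * avg j A F.
Proof.
elim: j A F => [|j IH] A F //=.
rewrite [RHS]mulrCA [in RHS]mulr_sumr; congr (_ * _).
by apply: eq_bigr => f _; rewrite IH.
Qed.

Lemma avg_bounds j A F : (forall s, 0 <= F s <= 1) -> 0 <= avg j A F <= 1.
Proof.
elim: j A F => [|j IH] A F F01 //=.
have IH' f := IH (A :\ f) (fun s => F (rcons s f)) (fun s => F01 _).
apply/andP; split.
  apply: mulr_ge0; first by rewrite invr_ge0 ler0n.
  by apply: sumr_ge0 => f _; case/andP: (IH' f).
have [/eqP A0|A0] := eqVneq #|A| 0%N.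
  by rewrite (eqP A0) invr0 mul0r ler01.
rewrite mulrC ler_pdivrMr ?ltr0n ?lt0n // mul1r.
apply: (@le_trans _ _ (\sum_(f in A) 1)); last by rewrite sumr_const.
by apply: ler_sum => f _; case/andP: (IH' f).
Qed.

(** Exchangeability: setting aside a uniform element before sampling does not change the law of the
    sample. The induction swaps that element with the last one of the sample. *)
Lemma avg_drop j A F : (j < #|A|)%N ->
  #|A|%:R^-1 * \sum_(f in A) avg j (A :\ f) F = avg j A F.
Proof.
elim: j A F => [|j IH] A F jA.
  by rewrite /= sumr_const -[F [::] *+ _]mulr_natl mulKf // card_neq0.
rewrite [RHS]/=; congr (_ * _).
transitivity (\sum_(g in A) #|A|.-1%:R^-1 * \sum_(f in A :\ g)
    avg j (A :\ g :\ f) (fun s => F (rcons s g))); last first.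
  apply: eq_bigr => g gA; rewrite -(cardsD1_pred gA) IH //.
  by rewrite cardsD1_pred //; lia.
transitivity (\sum_(f in A) \sum_(g in A | f != g) #|A|.-1%:R^-1 *
    avg j (A :\ f :\ g) (fun s => F (rcons s g))).
  apply: eq_bigr => f fA /=; rewrite cardsD1_pred // mulr_sumr.
  by apply: eq_bigl => g; rewrite !inE andbC eq_sym.
rewrite (exchange_big_dep (mem A)) /=; last by move=> f g _ /andP[].
apply: eq_bigr => g gA; rewrite mulr_sumr.
apply: eq_big => [f|f _]; first by rewrite !inE gA andbC.
by rewrite !finset.setDDl finset.setUC.
Qed.

Fixpoint samples (j : nat) A : seq (seq T) :=
  if j is i.+1 then [seq rcons s f | f <- enum A, s <- samples i (A :\ f)]
  else [:: [::]].

Lemma mem_samples j A s :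
  (s \in samples j A) = [&& size s == j, uniq s & all (mem A) s].
Proof.
elim: j A s => [|j IH] A s; first by case: s.
apply/allpairsPdep/and3P => [[f [t [fA tA ->]]]|].
  move: tA; rewrite IH mem_enum in fA * => /and3P[/eqP st ut /allP tA].
  split; first by rewrite size_rcons st.
  - by rewrite rcons_uniq ut andbT; apply/negP => /tA; rewrite /= !inE eqxx.
  - rewrite all_rcons /= fA; apply/allP => x /tA /=.
    by rewrite !inE => /andP[].
case/lastP: s => [[]//|s f]; rewrite size_rcons eqSS rcons_uniq all_rcons.
case=> sj /andP[fs us] /andP[/= fA /allP sA]; exists f, s; split => //.
  by rewrite mem_enum.
rewrite IH sj us; apply/allP => x xs /=; rewrite !inE (sA x xs : x \in A) andbT.
by apply: contraNneq fs => <-.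
Qed.

Lemma uniq_samples j A : uniq (samples j A).
Proof.
elim: j A => [|j IH] A //=; apply: allpairs_uniq_dep.
- exact: enum_uniq.
- by move=> f _; apply: IH.
- move=> [f s] [g t] _ _ /= /rcons_inj [-> ->] //.
Qed.

Lemma avg_samples j A F : (j <= #|A|)%N ->
  avg j A F = (#|A| ^_ j)%:R^-1 * \sum_(s <- samples j A) F s.
Proof.
elim: j A F => [|j IH] A F jA; first by rewrite /= big_seq1 invr1 mul1r.
rewrite [LHS]/= [samples _ _]/= big_allpairs_dep big_enum /= mulr_sumr mulr_sumr.
apply: eq_bigr => f fA; rewrite IH; last by rewrite cardsD1_pred //; lia.
by rewrite cardsD1_pred // mulrA ffactnS natrM invfM.
Qed.

End OrderedSamples.

(** * Uniform arrival orders as samples of full length *)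

Lemma arrival_inj (G : sgraph) : injective (@arrival G).
Proof.
by move=> p q /eq_in_map pq; apply/permP => e; apply: pq; rewrite mem_enum.
Qed.

Lemma arrival_surj (G : sgraph) (s : seq (edge G)) :
  size s = #|edge G| -> uniq s -> exists p, s = arrival p.
Proof.
case: s => [|x0 s0] sz us.
  by exists 1%g; apply/esym/size0nil; rewrite size_map -cardE -sz.
move: (x0 :: s0) sz us => s sz us; pose f e := nth e s (index e (enum (edge G))).
have idx e : (index e (enum (edge G)) < size s)%N.
  by rewrite sz cardE index_mem mem_enum.
have f_inj : injective f.
  move=> e e'; rewrite /f (set_nth_default e) // => /eqP.
  rewrite nth_uniq // => /eqP /(congr1 (nth e (enum (edge G)))).
  by rewrite !nth_index // mem_enum.
exists (perm f_inj); apply: (@eq_from_nth _ x0) => [|i si].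
  by rewrite size_map -cardE.
have se : (i < size (enum (edge G)))%N by rewrite -cardE -sz.
rewrite (nth_map x0) // permE /f index_uniq ?enum_uniq //.
exact: set_nth_default.
Qed.

(** Samples of full length and arrival orders are the same duplicate-free lists, and both means are
    normalised by the factorial of the number of edges. *)
Lemma avg_arrival (R : realType) (G : sgraph) (F : seq (edge G) -> R) :
  #|{perm edge G}|%:R^-1 * \sum_(p : {perm edge G}) F (arrival p) =
  avg #|edge G| (finset.setTfor (edge G)) F.
Proof.
rewrite avg_samples ?cardsT // ffactnn.
have -> : #|{perm edge G}| = (#|edge G|)`!%N.
  by rewrite -[in RHS]cardsT -card_perm; apply: eq_card => p;
    rewrite !inE; apply/esym/fintype.subsetP => x; rewrite inE.
congr (_ * _); rewrite -[LHS]big_enum -(big_map (@arrival G) xpredT) /=.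
apply: perm_big; apply: uniq_perm; rewrite ?uniq_samples //.
  by rewrite map_inj_uniq ?enum_uniq //; apply: arrival_inj.
move=> s; rewrite mem_samples; apply/mapP/and3P => [[p _ ->]|[/eqP sz us _]].
  split; first by rewrite size_map -cardE.
    by rewrite map_inj_uniq ?enum_uniq //; apply: perm_inj.
  by apply/allP => x _ /=; rewrite inE.
by have [p ->] := arrival_surj sz us; exists p; rewrite ?mem_enum.
Qed.

(** * Unmatched sets in a single greedy run *)

Section GreedyRandomStates.
Variables (R : realType) (I : input R).
Local Notation E := (edge (graph I)).
Local Notation V := (vertex (graph I)).
Implicit Types (X : {ffun E -> bool}) (S : {set V}) (s : seq E) (e f : E).

Definition free (M : {set E}) S : bool := [forall v in S, ~~ matched M v].

Definition touches f S : bool := ~~ [disjoint val f & S].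

Lemma freeP (M : {set E}) S :
  reflect (forall v, v \in S -> ~~ matched M v) (free M S).
Proof. exact: forall_inP. Qed.

Lemma freeU (M : {set E}) S S' : free M (S :|: S') = free M S && free M S'.
Proof.
apply/freeP/andP => [fr|[/freeP fr /freeP fr'] v].
  by split; apply/freeP => v vS; apply: fr; rewrite inE vS ?orbT.
by rewrite inE => /orP[/fr|/fr'].
Qed.

Lemma matchedU1 (M : {set E}) f v :
  matched (f |: M) v = incident v f || matched M v.
Proof.
apply/exists_inP/orP => [[g]|[vf|/exists_inP[g gM vg]]].
- by rewrite !inE => /orP[/eqP->|gM] vg; [left|right; apply/exists_inP; exists g].
- by exists f; rewrite ?inE ?eqxx.
- by exists g; rewrite ?inE ?gM ?orbT.
Qed.

Lemma freeU1 (M : {set E}) f S :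
  free (f |: M) S = free M S && [disjoint val f & S].
Proof.
rewrite disjoint_sym disjoint_subset.
apply/freeP/andP => [fr|[/freeP fr /fintype.subsetP fS] v vS].
  split; [apply/freeP => v vS|apply/fintype.subsetP => v vS].
    by have := fr v vS; rewrite matchedU1 negb_or => /andP[].
  by have := fr v vS; rewrite matchedU1 negb_or => /andP[].
by rewrite matchedU1 negb_or fr // andbT; apply: fS.
Qed.

Lemma greedy_rcons X s f : greedy X (rcons s f) =
  if X f && free (greedy X s) (val f) then f |: greedy X s else greedy X s.
Proof. by rewrite /greedy -cats1 foldl_cat. Qed.

Lemma greedy_sub X s : {subset greedy X s <= [pred e | (e \in s) && X e]}.
Proof.
elim/last_ind: s => [|s f IH] e; first by rewrite inE.
rewrite greedy_rcons; have sub : e \in greedy X s -> (e \in rcons s f) && X e.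
  by move=> /IH /andP[es ->]; rewrite mem_rcons inE es orbT.
case: ifP => [/andP[Xf _]|_]; last exact: sub.
rewrite !inE => /orP[/eqP->|/sub//].
by rewrite mem_rcons mem_head.
Qed.

(** [S] stops being free only if [f] joins the matching and shares a vertex with [S]. This holds
    outcome by outcome, before any averaging. *)
Lemma free_greedy_rcons X s f S :
  (free (greedy X (rcons s f)) S)%:R = (free (greedy X s) S)%:R -
    (touches f S)%:R * ((X f)%:R * (free (greedy X s) (S :|: val f))%:R) :> R.
Proof.
rewrite greedy_rcons freeU /touches; case: (X f) => /=; last first.
  by rewrite mul0r mulr0 subr0.
case: ifP => [_|_]; last by rewrite andbF !mulr0 subr0.
by rewrite freeU1 andbT; case: (free _ S); case: [disjoint _ & _];
  rewrite /= ?mul0r ?mulr0 ?mul1r ?subr0 ?subrr.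
Qed.

(** * Independent edge states for a fixed arrival order *)

Definition weight X : R := \prod_e (if X e then xval e else 1 - xval e).

Lemma weight_ge0 X : 0 <= weight X.
Proof.
apply: prodr_ge0 => e _; case: ifP => _; first exact: xval_ge0.
by rewrite subr_ge0 xval_le1.
Qed.

Lemma sum_weight : \sum_X weight X = 1.
Proof.
rewrite /weight -(bigA_distr_bigA (fun e b => if b then xval e else 1 - xval e)).
by rewrite big1 // => e _; rewrite big_bool /= addrC subrK.
Qed.

Definition flip f X : {ffun E -> bool} :=
  [ffun g => if g == f then ~~ X g else X g].

Lemma flipK f : involutive (flip f).
Proof.
by move=> X; apply/ffunP => g; rewrite !ffunE; case: eqP => // _; rewrite negbK.
Qed.

Lemma weight_flip f X : X f ->
  xval f * weight (flip f X) = (1 - xval f) * weight X.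
Proof.
move=> Xf; rewrite /weight (bigD1 f) //= [in RHS](bigD1 f) //= Xf ffunE eqxx Xf /= mulrCA.
congr (_ * (_ * _)); apply: eq_bigr => g gf.
by rewrite ffunE (negbTE gf).
Qed.

(** [flip f] pairs the states where [f] is active with those where it is not. [H] agrees on each
    pair, and [weight_flip] relates the two weights without dividing by [xval f]. *)
Lemma weight_indep f (H : {ffun E -> bool} -> R) :
  (forall X, H (flip f X) = H X) ->
  \sum_X weight X * ((X f)%:R * H X) = xval f * \sum_X weight X * H X.
Proof.
move=> Hf; rewrite [in RHS](bigID (fun X : {ffun E -> bool} => X f)) /=.
rewrite [X in _ * (_ + X)](reindex_inj (inv_inj (@flipK f))) /=.
rewrite [X in _ * (_ + X)](eq_bigl (fun X : {ffun E -> bool} => X f)); last first.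
  by move=> X; rewrite ffunE eqxx negbK.
rewrite -big_split /= mulr_sumr [LHS](bigID (fun X : {ffun E -> bool} => X f)) /=.
rewrite [X in _ + X]big1 ?addr0; last first.
  by move=> X /negbTE->; rewrite mul0r mulr0.
apply: eq_bigr => X Xf; rewrite Xf mul1r Hf -mulrDl mulrA mulrDr.
by rewrite weight_flip // -mulrDl addrC subrK mul1r.
Qed.

Lemma greedy_flip f X s : f \notin s -> greedy (flip f X) s = greedy X s.
Proof.
elim/last_ind: s => [//|s g IH]; rewrite mem_rcons inE negb_or => /andP[fg fs].
by rewrite !greedy_rcons IH // ffunE eq_sym (negbTE fg).
Qed.

Definition free_prob S s : R := \sum_X weight X * (free (greedy X s) S)%:R.

Definition sel_prob e s : R := \sum_X weight X * (e \in greedy X s)%:R.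

Lemma free_prob_bounds S s : 0 <= free_prob S s <= 1.
Proof.
apply/andP; split.
  by apply: sumr_ge0 => X _; rewrite mulr_ge0 ?weight_ge0 ?ler0n.
rewrite -sum_weight; apply: ler_sum => X _.
by rewrite ler_piMr ?weight_ge0 ?lern1 ?leq_b1.
Qed.

Lemma free_prob_nil S : free_prob S [::] = 1.
Proof.
rewrite -sum_weight; apply: eq_bigr => X _.
suff -> : free (greedy X [::]) S by rewrite mulr1.
by apply/freeP => v _; apply/exists_inP => -[f]; rewrite inE.
Qed.

(** A run that has not yet met [f] is independent of the state of [f], so activity contributes the
    factor [xval f]. *)
Lemma free_prob_rcons S s f : f \notin s -> free_prob S (rcons s f) =
  free_prob S s - (touches f S)%:R * xval f * free_prob (S :|: val f) s.
Proof.
move=> fs; rewrite /free_prob -mulrA.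
rewrite -(@weight_indep f (fun X => (free (greedy X s) (S :|: val f))%:R)).
  rewrite mulr_sumr -sumrB; apply: eq_bigr => X _.
  by rewrite free_greedy_rcons mulrBr [in X in _ - X]mulrCA.
by move=> X; rewrite greedy_flip.
Qed.

Lemma sel_prob_notin e s : e \notin s -> sel_prob e s = 0.
Proof.
move=> es; apply: big1 => X _; case eX : (e \in greedy X s); last by rewrite mulr0.
by have /andP[] := greedy_sub eX; rewrite (negbTE es).
Qed.

Lemma sel_prob_rcons e f s : f != e -> sel_prob e (rcons s f) = sel_prob e s.
Proof.
move=> fe; apply: eq_bigr => X _; congr (_ * _%:R); rewrite greedy_rcons.
by case: ifP => // _; rewrite !inE eq_sym (negbTE fe).
Qed.

Lemma sel_prob_rcons_same e s : e \notin s ->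
  sel_prob e (rcons s e) = xval e * free_prob (val e) s.
Proof.
move=> es; rewrite /free_prob.
rewrite -(@weight_indep e (fun X => (free (greedy X s) (val e))%:R)); last first.
  by move=> X; rewrite greedy_flip.
apply: eq_bigr => X _; congr (_ * _); rewrite -natrM mulnb greedy_rcons.
have eM : e \notin greedy X s.
  by apply/negP => /greedy_sub /andP[]; rewrite (negbTE es).
by congr (_%:R); case: ifP => _; rewrite ?inE ?eqxx // (negbTE eM).
Qed.

(** * Averaging over the arrival order; selection probabilities *)

Definition mean_free S (A : {set E}) j : R := avg j A (free_prob S).

Lemma mean_free_bounds S (A : {set E}) j : 0 <= mean_free S A j <= 1.
Proof. by apply: avg_bounds => s; apply: free_prob_bounds. Qed.

(* The edge arriving at step [j] can only spoil [S] if it is active, touches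
   [S], and finds both [S] and its own endpoints unmatched: the hierarchy closes
   without any approximation. *)
Lemma mean_freeS S (A : {set E}) j : (j < #|A|)%N ->
  mean_free S A j.+1 = mean_free S A j - #|A|%:R^-1 *
    \sum_(f in A | touches f S) xval f * mean_free (S :|: val f) (A :\ f) j.
Proof.
move=> jA; rewrite /mean_free -(avg_drop _ jA) -mulrBr /=; congr (_ * _).
rewrite [in X in _ - X]big_mkcondr /= -sumrB; apply: eq_bigr => f fA.
rewrite -mulrb -mulr_natl mulrA -avgZ -avgB; apply: eq_avg => s sA.
by rewrite free_prob_rcons //; apply/negP => /sA; rewrite !inE eqxx.
Qed.

(** Each arrival is [e] with the same probability [1 / #|A|]; if [i] other edges precede it, [e] is
    selected exactly when it is active and its endpoints are still free. *)
Lemma avg_sel_prob e (A : {set E}) j : e \in A -> (j <= #|A|)%N ->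
  avg j A (sel_prob e) =
  xval e / #|A|%:R * \sum_(i < j) mean_free (val e) (A :\ e) i.
Proof.
move=> eA; elim: j => [|j IH] jA.
  by rewrite big_ord0 mulr0 /= sel_prob_notin.
rewrite big_ord_recr /= mulrDr -IH ?(ltnW jA) // -(avg_drop _ jA).
rewrite -mulrA mulrCA -mulrDr; congr (_ * _).
rewrite !(big_setD1 e eA) /= -avgZ addrAC.
(* Samples from [A :\ e] never contain [e]. The constant is written [0 * 0] so that [avgZ] evaluates
   its mean. *)
have -> : avg j (A :\ e) (sel_prob e) = 0.
  rewrite (@eq_avg _ _ _ _ _ (fun=> 0 * 0)) ?avgZ ?mul0r // => s sA.
  by rewrite sel_prob_notin //; apply/negP => /sA; rewrite !inE eqxx.
rewrite add0r; congr (_ + _); last first.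
  by apply: eq_bigr => f /setD1P[fe _]; apply: eq_avg => s _; apply: sel_prob_rcons.
apply: eq_avg => s sA; apply: sel_prob_rcons_same.
by apply/negP => /sA; rewrite !inE eqxx.
Qed.

Lemma Pr_sum (A : {set outcome I}) : Pr A = #|{perm E}|%:R^-1 *
  \sum_(p : {perm E}) \sum_X weight X * ((X, p) \in A)%:R.
Proof.
rewrite exchange_big pair_big /= /Pr big_mkcond mulr_sumr.
apply: eq_bigr => -[X p] _; rewrite /pmf /=.
by case: ifP => _; rewrite ?mulr1 ?mulr0 // mulrC.
Qed.

Lemma Pr_active e : Pr (active e) = xval e.
Proof.
rewrite Pr_sum (eq_bigr (fun=> xval e)) => [|p _].
  rewrite sumr_const -[X in _ * X]mulr_natl mulKf // pnatr_eq0 -lt0n.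
  by apply/card_gt0P; exists 1%g.
have := @weight_indep e (fun=> 1) (fun=> erefl).
under eq_bigr do rewrite mulr1.
under [X in _ * X]eq_bigr do rewrite mulr1.
rewrite sum_weight mulr1 => <-.
by apply: eq_bigr => X _; rewrite inE.
Qed.

Lemma Pr_selected e : Pr (selected e :&: active e) =
  avg #|E| (finset.setTfor E) (sel_prob e).
Proof.
rewrite -avg_arrival Pr_sum; congr (_ * _); apply: eq_bigr => p _.
apply: eq_bigr => X _; rewrite !inE /=; congr (_ * _%:R).
by rewrite andb_idr // => /greedy_sub /andP[].
Qed.

Lemma cPr_selected e : 0 < xval e ->
  cPr (selected e) (active e) = #|E|%:R^-1 *
    \sum_(j < #|E|) mean_free (val e) (finset.setTfor E :\ e) j.
Proof.
move=> xe; rewrite /cPr Pr_active Pr_selected avg_sel_prob ?cardsT ?inE //.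
by rewrite mulrAC [_ / _ / _]mulrAC divff ?gt_eqF // mul1r.
Qed.

End GreedyRandomStates.

(** * Rising factorials and the discrete mean-field solution *)

Section MeanField.
Variable R : realType.
Implicit Types (x y : R) (k j N : nat).

Definition rising x k : R := \prod_(i < k) (x + i%:R).

Lemma risingS x k : rising x k.+1 = rising x k * (x + k%:R).
Proof. by rewrite /rising big_ord_recr. Qed.

Lemma rising_recl x k : rising x k.+1 = x * rising (x + 1) k.
Proof.
rewrite /rising big_ord_recl addr0; congr (_ * _); apply: eq_bigr => i _.
by rewrite /= /bump /= natrD addrA.
Qed.

Lemma rising_gt0 x k : 0 < x -> 0 < rising x k.
Proof. by move=> x0; apply: prodr_gt0 => i _; rewrite ltr_pwDl. Qed.

Lemma ler_rising x y k : 0 <= x -> x <= y -> rising x k <= rising y k.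
Proof.
by move=> x0 xy; apply: ler_prod => i _; rewrite addr_ge0 ?ler0n ?lerD2r.
Qed.

(* The discrete analogue of [(1 + j / N) ^- k]: in place of
   [h' = - h ^ 2] for [h t = 1 / (1 + t)], the rising factorials satisfy an
   exact difference equation. *)
Definition mean_field N k j : R := rising N%:R k / rising (N + j)%:R k.

Lemma mean_field0 N k : (0 < N)%N -> mean_field N k 0 = 1.
Proof. by move=> N0; rewrite /mean_field addn0 divff // gt_eqF // rising_gt0 ?ltr0n. Qed.

Lemma mean_field_bounds N k j : (0 < N)%N -> 0 <= mean_field N k j <= 1.
Proof.
move=> N0; have N0' : 0 < N%:R :> R by rewrite ltr0n.
have Nj0 : 0 < (N + j)%:R :> R by rewrite ltr0n addn_gt0 N0.
apply/andP; split; first by apply: divr_ge0; apply/ltW/rising_gt0.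
rewrite /mean_field ler_pdivrMr ?rising_gt0 // mul1r.
by rewrite ler_rising ?ler_nat ?leq_addr ?ler0n.
Qed.

Lemma mean_fieldS N k j : (0 < N)%N ->
  mean_field N k j.+1 =
  mean_field N k j - k%:R / (N + k)%:R * mean_field N k.+1 j.
Proof.
move=> N0; have N0' : 0 < N%:R :> R by rewrite ltr0n.
have j0 : 0 <= j%:R :> R by rewrite ler0n.
have k0 : 0 <= k%:R :> R by rewrite ler0n.
have rN := rising_gt0 k N0'.
have rNj : 0 < rising (N%:R + j%:R) k by apply: rising_gt0; rewrite ltr_pwDl.
have rNj1 : 0 < rising (N%:R + j%:R + 1) k.
  by apply: rising_gt0; rewrite !ltr_pwDl ?ltr01.
rewrite /mean_field addnS -natr1 !natrD !risingS.
have e := rising_recl (N%:R + j%:R) k; rewrite risingS in e.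
have -> : rising (N%:R + j%:R + 1) k =
    rising (N%:R + j%:R) k * (N%:R + j%:R + k%:R) / (N%:R + j%:R).
  by rewrite e mulrAC divff ?mul1r // gt_eqF // ltr_pwDl.
by field; rewrite !gt_eqF //; lra.
Qed.

Lemma mean_field1 N j : mean_field N 1 j = N%:R / (N + j)%:R.
Proof. by rewrite /mean_field /rising !big_ord1 !addr0. Qed.

(** Discrete form of the integral of [h^2] over [[0,t]], which is [t / (1 + t)]. It telescopes:
    [mean_field N 2] is [N + 1] times the decrement of [mean_field N 1]. *)
Lemma sum_mean_field2 N j : (0 < N)%N ->
  \sum_(i < j) mean_field N 2 i = N.+1%:R * (j%:R / (N + j)%:R).
Proof.
move=> N0; have Nj i : (N + i)%:R != 0 :> R by rewrite pnatr_eq0; lia.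
elim: j => [|j IH]; first by rewrite big_ord0 mul0r mulr0.
rewrite big_ord_recr /= IH.
have := mean_fieldS 1 j N0; rewrite !mean_field1.
have := Nj 1; have := Nj j; have := Nj j.+1; rewrite !addnS addn0 -!natr1 natrD.
move=> h1 h2 h3 h; have -> : mean_field N 2 j = (N%:R + 1) *
    (N%:R / (N%:R + j%:R) - N%:R / (N%:R + j%:R + 1)).
  by rewrite h; field; rewrite h3 h2.
by field; rewrite h1 h2.
Qed.

End MeanField.

(** * Comparing the exact hierarchy with the mean field *)

Section Hierarchy.
Variables (R : realType) (I : input R) (eps : R).
Hypothesis regular : one_regular I.
Hypothesis xval_le : forall e : edge (graph I), xval e <= eps.
Local Notation E := (edge (graph I)).
Local Notation V := (vertex (graph I)).
Implicit Types (S : {set V}) (e f : E).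

Definition crossing f S : bool := #|val f :&: S| == 1%N.

Lemma card_edge f : #|val f| = 2%N.
Proof. exact/edges_card2/valP. Qed.

Lemma card_edgeI f S : #|val f :&: S| =
  (crossing f S + 2 * (val f \subset S))%N :> nat.
Proof.
have := fintype.subset_leq_card (finset.subsetIl (val f) S).
rewrite card_edge /crossing => le2.
have -> : (val f \subset S) = (#|val f :&: S| == 2)%N.
  rewrite -(card_edge f); apply/idP/idP => [/finset.setIidPl->//|fS].
  by apply/finset.setIidPl/eqP; rewrite eqEcard (eqP fS) leqnn finset.subsetIl.
by move: le2; case: #|_| => [|[|[|]]].
Qed.

Lemma touchesE f S : touches f S = crossing f S || (val f \subset S).
Proof.
rewrite /touches -finset.setI_eq0 -cards_eq0 card_edgeI.
by case: crossing; case: (_ \subset _).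
Qed.

Lemma crossing_notsub f S : crossing f S -> ~~ (val f \subset S).
Proof.
move=> fS; apply/negP => sub; have := card_edgeI f S.
by rewrite fS sub (eqP fS).
Qed.

Lemma card_setU_crossing f S : crossing f S -> #|S :|: val f| = #|S|.+1.
Proof.
by move=> /eqP fS; rewrite finset.setUC cardsU fS card_edge; lia.
Qed.

(** Double counting: in the sum of the regularity equations over [S], a crossing edge appears once
    and an edge inside [S] twice. *)
Lemma sum_crossing S : \sum_(f | crossing f S) xval f +
  2 * \sum_(f : E | val f \subset S) xval f = #|S|%:R :> R.
Proof.
have -> : #|S|%:R = \sum_f xval f * #|val f :&: S|%:R :> R.
  rewrite -sumr_const -(eq_bigr _ (fun v _ => regular v)).
  rewrite (exchange_big_dep xpredT) //=; apply: eq_bigr => f _.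
  rewrite sumr_const mulr_natr; congr (_ *+ _); apply: eq_card => v.
  by rewrite !inE /incident andbC.
rewrite mulr_sumr big_mkcond [X in _ + X]big_mkcond -big_split /=.
apply: eq_bigr => f _; rewrite card_edgeI natrD natrM mulrDr.
by case: crossing; case: (_ \subset _); rewrite /= ?mulr0 ?mulr1 // mulrC.
Qed.

Lemma eps_ge0 e : 0 <= eps.
Proof. exact: le_trans (xval_ge0 e) (xval_le e). Qed.

Lemma sum_inner_le S e :
  \sum_(f : E | val f \subset S) xval f <= (2 ^ #|S|)%:R * eps.
Proof.
apply: (@le_trans _ _ (\sum_(f : E | val f \subset S) eps)).
  by apply: ler_sum => f _; apply: xval_le.
rewrite sumr_const -[_ *+ _]mulr_natl ler_wpM2r ?(eps_ge0 e) // ler_nat.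
rewrite -card_powerset -(card_imset _ (@val_inj _ _ E)).
apply/fintype.subset_leq_card/fintype.subsetP => _ /imsetP[f fS ->].
by rewrite powersetE.
Qed.

(** The edges at one endpoint of [e] have total value 1, at most [eps] each. Errors of order
    [1 / #|E|] are therefore of order [eps]. *)
Lemma card_edges_ge e : 1 <= #|E|%:R * eps.
Proof.
have /card_gt0P[v _] : (0 < #|val e|)%N by rewrite card_edge.
rewrite -[X in X <= _](regular v) mulr_natl -sumr_const big_mkcond /=.
by apply: ler_sum => f _; case: ifP => _; rewrite ?xval_le ?(eps_ge0 e).
Qed.

(** All crossing edges lie in [A]. Their total value is [#|S|] minus twice the value inside [S], and
    the latter is at most [2 ^ #|S| * eps]. *)
Lemma touching_sum_approx S (A : {set E}) (q : E -> R) (g B : R) e :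
  (forall f, f \notin A -> val f \subset S) -> 0 <= B -> 0 <= g <= 1 ->
  (forall f, 0 <= q f <= 1) ->
  (forall f, crossing f S -> `|q f - g| <= B) ->
  `|\sum_(f in A | touches f S) xval f * q f - #|S|%:R * g| <=
  #|S|%:R * B + 2 * (2 ^ #|S|)%:R * eps.
Proof.
move=> AS B0 /andP[g0 g1] q01 qB.
have splitE : \sum_(f in A | touches f S) xval f * q f =
    \sum_(f | crossing f S) xval f * q f +
    \sum_(f in A | val f \subset S) xval f * q f.
  rewrite (bigID (fun f => crossing f S)) /=; congr (_ + _); apply: eq_bigl => f.
    rewrite touchesE; have [fS|_] := boolP (crossing f S); last by rewrite andbF.
    by rewrite andbT /= andbT; apply: contraT => /AS; rewrite (negbTE (crossing_notsub fS)).
  rewrite touchesE; have [fS|_] := boolP (crossing f S); last by rewrite andbT.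
  by rewrite andbF (negbTE (crossing_notsub fS)) andbF.
set Wo := \sum_(f | crossing f S) xval f; set Wi := \sum_(f : E | val f \subset S) xval f.
have WE : Wo + 2 * Wi = #|S|%:R := sum_crossing S.
have Wi0 : 0 <= Wi by apply: sumr_ge0 => f _; apply: xval_ge0.
have Wile : Wi <= (2 ^ #|S|)%:R * eps := sum_inner_le S e.
have inner0 : 0 <= \sum_(f in A | val f \subset S) xval f * q f.
  by apply: sumr_ge0 => f _; rewrite mulr_ge0 ?xval_ge0 //; case/andP: (q01 f).
have inner1 : \sum_(f in A | val f \subset S) xval f * q f <= Wi.
  rewrite [X in X <= _]big_mkcond [X in _ <= X]big_mkcond; apply: ler_sum => f _.
  have /andP[q0 q1] := q01 f.
  case: (f \in A); case: (_ \subset _) => //=; last exact: xval_ge0.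
  by rewrite ler_piMr ?xval_ge0.
have outer : `|\sum_(f | crossing f S) xval f * q f - Wo * g| <= Wo * B.
  rewrite /Wo !mulr_suml -sumrB; apply: le_trans (ler_norm_sum _ _ _) _.
  apply: ler_sum => f fS; rewrite -mulrBr normrM ger0_norm ?xval_ge0 //.
  by rewrite ler_wpM2l ?xval_ge0 // qB.
have Wig : Wi * g <= Wi by rewrite ler_piMr.
have Wig0 : 0 <= Wi * g by rewrite mulr_ge0.
have WiB : 0 <= Wi * B by rewrite mulr_ge0.
rewrite splitE -WE; move: outer; rewrite !ler_norml => /andP[lb ub].
by apply/andP; split; lra.
Qed.

(** The product [k (k+1) ... (k+r-1)], built in the order in which the hierarchy is unfolded. *)
Fixpoint rise r k : nat := if r is r'.+1 then (k * rise r' k.+1)%N else 1%N.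

Fixpoint loss r k : nat :=
  if r is r'.+1 then (k * loss r' k.+1 + 2 * 2 ^ k + 2 * k ^ 2)%N else 0%N.

(* Unfolding the hierarchy [r] times: the first term is the remainder, an
   [r]-fold iterated sum of the trivial bound 1, and [loss] collects the effect
   of edges inside [S] and of sampling without replacement. *)
Lemma mean_free_approx r n j S (A : {set E}) e :
  (forall f, f \notin A -> val f \subset S) ->
  (0 < #|S|)%N -> (#|A| + #|S| = #|E|.+1)%N -> (0 < n)%N -> (n + r <= #|A|)%N -> (j <= n)%N ->
  `|mean_free S A j - mean_field R #|E| #|S| j| <=
  (rise r #|S| * 'C(j, r))%:R / n%:R ^+ r + j%:R / n%:R * ((loss r #|S|)%:R * eps).
Proof.
have N0 : (0 < #|E|)%N by apply/card_gt0P; exists e.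
have e0 := eps_ge0 e.
elim: r n j S A => [|r IHr] n j S A AS S0 ASN n0 nA jn.
  rewrite mul0r mulr0 addr0 expr0 divr1 bin0 /= ler_norml.
  have /andP[q0 q1] := mean_free_bounds S A j.
  have /andP[g0 g1] := mean_field_bounds R #|S| j N0.
  by apply/andP; split; lra.
(* Inner induction on time: each arrival adds an error controlled by the outer hypothesis for sets
   with one more vertex. *)
elim: j jn => [|j IHj] jn.
  rewrite {1}/mean_free /= free_prob_nil mean_field0 // subrr normr0.
  by rewrite addr_ge0 ?mulr_ge0 ?divr_ge0 ?exprn_ge0 ?ler0n.
have n0' : 0 < n%:R :> R by rewrite ltr0n.
have jA : (j < #|A|)%N by lia.
set k := #|S| in S0 ASN IHj *; set a := #|A| in ASN nA jA.
set B := (rise r k.+1 * 'C(j, r))%:R / n%:R ^+ r + (loss r k.+1)%:R * eps.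
have B0 : 0 <= B by rewrite /B addr_ge0 ?mulr_ge0 ?invr_ge0 ?exprn_ge0 ?ler0n.
have g01 := mean_field_bounds R k.+1 j N0.
set g := mean_field R #|E| k.+1 j in g01.
set D := \sum_(f in A | touches f S) xval f * mean_free (S :|: val f) (A :\ f) j.
have step : `|D - k%:R * g| <= k%:R * B + 2 * (2 ^ k)%:R * eps.
  apply: touching_sum_approx => // [f|f fS]; first exact: mean_free_bounds.
  have fA : f \in A.
    by apply: contraT => /AS; rewrite (negbTE (crossing_notsub fS)).
  (* Moving a crossing edge from [A] into [S] preserves the invariants: deleted edges lie inside
     [S], and [#|A| + #|S|] is unchanged. *)
  have := IHr n j (S :|: val f) (A :\ f); rewrite card_setU_crossing // => IH.
  apply: le_trans (IH _ _ _ n0 _ (ltnW jn)) _.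
  - move=> f'; rewrite !inE negb_and negbK => /orP[/eqP->|/AS f'S].
      exact: finset.subsetUr.
    exact: fintype.subset_trans f'S (finset.subsetUl _ _).
  - by [].
  - by rewrite cardsD1_pred //; move: S0 ASN nA jA; clear; lia.
  - by rewrite cardsD1_pred //; move: S0 ASN nA jA; clear; lia.
  - rewrite lerD2l ler_piMl ?mulr_ge0 ?ler0n // ler_pdivrMr // mul1r ler_nat.
    exact: ltnW.
have a0 : 0 < a%:R :> R by rewrite ltr0n (leq_trans _ jA).
have na : a%:R^-1 <= n%:R^-1 :> R by rewrite lef_pV2 ?posrE // ler_nat (leq_trans _ nA) ?leq_addr.
have N0' : 0 < #|E|%:R :> R by rewrite ltr0n.
have k0 : 0 <= k%:R :> R by rewrite ler0n.
have aN : a%:R + k%:R = #|E|%:R + 1 :> R by rewrite -natrD ASN natr1.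
have aN' : a%:R <= #|E|%:R + k%:R :> R.
  by rewrite -natrD ler_nat; move: S0 ASN; clear; lia.
have Nk0 : 0 < #|E|%:R + k%:R :> R by rewrite ltr_pwDl.
have gap0 : 0 <= a%:R^-1 - (#|E|%:R + k%:R)^-1 :> R.
  by rewrite subr_ge0 lef_pV2 ?posrE.
(* As [a + k = #|E| + 1], the relative gap is [(2k - 1) / (#|E| + k)], of order [eps] by
   [card_edges_ge]. *)
have gap1 : a%:R^-1 - (#|E|%:R + k%:R)^-1 <= a%:R^-1 * (2 * k%:R * eps) :> R.
  have -> : a%:R^-1 - (#|E|%:R + k%:R)^-1 =
      a%:R^-1 * ((#|E|%:R + k%:R - a%:R) / (#|E|%:R + k%:R)) :> R.
    by field; rewrite !gt_eqF.
  rewrite ler_pM2l ?invr_gt0 // ler_pdivrMr //.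
  have h1 : 0 <= k%:R * (#|E|%:R * eps - 1).
    by rewrite mulr_ge0 // subr_ge0 (card_edges_ge e).
  have h2 : 0 <= k%:R * k%:R * eps by rewrite !mulr_ge0.
  lra.
have /andP[g0 g1] := g01.
have key : `|a%:R^-1 * D - k%:R / (#|E| + k)%:R * g| <=
    n%:R^-1 * (k%:R * B + 2 * (2 ^ k)%:R * eps + 2 * k%:R ^+ 2 * eps).
  have -> : a%:R^-1 * D - k%:R / (#|E| + k)%:R * g = a%:R^-1 * (D - k%:R * g) +
      k%:R * (g * (a%:R^-1 - (#|E|%:R + k%:R)^-1)) by rewrite natrD; ring.
  apply: (@le_trans _ _ (a%:R^-1 *
      (k%:R * B + 2 * (2 ^ k)%:R * eps + 2 * k%:R ^+ 2 * eps))); last first.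
    by rewrite ler_wpM2r // !addr_ge0 ?mulr_ge0 ?ler0n ?exprn_ge0.
  apply: le_trans (ler_normD _ _) _; rewrite [leRHS]mulrDr; apply: lerD.
    by rewrite normrM gtr0_norm ?invr_gt0 // ler_pM2l ?invr_gt0.
  rewrite ger0_norm; last exact: mulr_ge0 k0 (mulr_ge0 g0 gap0).
  have -> : a%:R^-1 * (2 * k%:R ^+ 2 * eps) =
    k%:R * (a%:R^-1 * (2 * k%:R * eps)) by ring.
  by rewrite ler_wpM2l // (le_trans _ gap1) // ler_piMl.
rewrite mean_freeS // mean_fieldS // -/D -/g -/k.
have -> : forall x y z w : R, x - y - (z - w) = (x - z) - (y - w).
  by move=> *; ring.
apply: le_trans (ler_normB _ _) _.
apply: le_trans (lerD (IHj (ltnW jn)) key) _; rewrite le_eqVlt; apply/orP; left.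
(* Pascal's rule sums the remainders over time, in place of integrating [t^r]. *)
apply/eqP; rewrite /B /= binS !natrM !natrD !natrM !natrX -natr1 exprS.
by field; rewrite expf_neq0 gt_eqF.
Qed.

End Hierarchy.

(** * From the approximation to the selection probability *)

Lemma rise_fact r k : (rise r k.+1 * k`! = (r + k)`!)%N.
Proof.
elim: r k => [|r IH] k /=; first by rewrite mul1n.
by rewrite mulnAC mulnC -factS IH addnS.
Qed.

Lemma ffact_le_expn m n : (n ^_ m <= n ^ m)%N.
Proof. by elim: m => // m IH; rewrite ffactnSr expnSr leq_mul ?leq_subr. Qed.

Lemma sum_bin r j : (\sum_(i < j) 'C(i, r) = 'C(j, r.+1))%N.
Proof. by elim: j => [|j IH]; rewrite ?big_ord0 // big_ord_recr /= IH binS. Qed.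

(** Sums [mean_free_approx], started at the two endpoints of [e], over the first [J] steps; the
    later terms are nonnegative and are dropped. *)
Lemma cPr_selected_ge (R : realType) (I : input R) (eps : R) r n J
    (e : edge (graph I)) :
  one_regular I -> (forall f : edge (graph I), xval f <= eps) -> 0 < xval e ->
  (0 < n)%N -> (n + r < #|edge (graph I)|)%N -> (J <= n)%N ->
  J%:R / (#|edge (graph I)| + J)%:R - (J%:R / n%:R) ^+ r.+1 -
    (loss r 2)%:R * eps <= cPr (selected e) (active e).
Proof.
move=> reg xle xe n0 nN Jn; have e0 := eps_ge0 xle e.
rewrite cPr_selected //; set N := #|edge (graph I)| in nN *.
set Q := mean_free _ _.
have N0 : (0 < N)%N by apply: leq_ltn_trans nN.
have N0' : 0 < N%:R :> R by rewrite ltr0n.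
have n0' : 0 < n%:R :> R by rewrite ltr0n.
have cardA : #|finset.setTfor (edge (graph I)) :\ e| = N.-1.
  by rewrite cardsD1_pred ?inE // cardsT.
have Qge j : (j < J)%N -> mean_field R N 2 j -
    (r.+1)`!%:R * 'C(j, r)%:R / n%:R ^+ r - (loss r 2)%:R * eps <= Q j.
  move=> jJ; have jn : (j <= n)%N by apply: leq_trans (ltnW jJ) Jn.
  have := @mean_free_approx R I eps reg xle r n j (val e)
    (finset.setTfor (edge (graph I)) :\ e) e.
  rewrite cardA card_edge -/N -/Q => /(_ _ isT _ n0 _ jn) ap.
  have fE : rise r 2 = (r.+1)`!%N by rewrite -[r.+1]addn1 -(rise_fact r 1) muln1.
  move: ap; rewrite fE natrM => ap.
  have L0 : 0 <= (loss r 2)%:R * eps by rewrite mulr_ge0.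
  have jn1 : j%:R / n%:R * ((loss r 2)%:R * eps) <= (loss r 2)%:R * eps.
    by rewrite ler_piMl // ler_pdivrMr // mul1r ler_nat.
  suff /ler_normlP[] : `|Q j - mean_field R N 2 j| <=
      (r.+1)`!%:R * 'C(j, r)%:R / n%:R ^+ r + (loss r 2)%:R * eps by lra.
  apply: le_trans (ap _ _ _) _; last by rewrite lerD2l.
  - by move=> f; rewrite !inE andbT negbK => /eqP->.
  - by rewrite addn2 prednK.
  - by rewrite -ltnS prednK.
have sumQ : \sum_(j < J) Q j <= \sum_(j < N) Q j.
  have JN : (J <= N)%N by rewrite (leq_trans Jn) // (leq_trans _ (ltnW nN)) // leq_addr.
  rewrite -!(big_mkord xpredT Q) (big_cat_nat (leq0n J) JN) /= lerDl.
  by apply: sumr_ge0 => j _; case/andP: (mean_free_bounds (val e)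
    (finset.setTfor (edge (graph I)) :\ e) j).
have sumge : N.+1%:R * (J%:R / (N + J)%:R) - J%:R ^+ r.+1 / n%:R ^+ r -
    J%:R * ((loss r 2)%:R * eps) <= \sum_(j < J) Q j.
  apply: (@le_trans _ _ (\sum_(j < J) (mean_field R N 2 j -
    (r.+1)`!%:R * 'C(j, r)%:R / n%:R ^+ r - (loss r 2)%:R * eps))); last first.
    by apply: ler_sum => j _; apply: Qge.
  rewrite !sumrB sum_mean_field2 // sumr_const card_ord -[X in _ <= _ - X]mulr_natl lerD2r lerD2l.
  (* The binomials add up to ['C(J, r.+1)]; times [(r.+1)!] this is a falling factorial, at most
     [J ^ r.+1]. *)
  rewrite lerN2 -mulr_suml -mulr_sumr -natr_sum sum_bin -natrM mulnC bin_ffact.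
  by rewrite ler_wpM2r ?invr_ge0 ?exprn_ge0 ?ler0n // -natrX ler_nat ffact_le_expn.
have nN' : N%:R^-1 <= n%:R^-1 :> R.
  by rewrite lef_pV2 ?posrE // ler_nat (leq_trans _ (ltnW nN)) ?leq_addr.
have JN1 : N%:R^-1 * J%:R <= 1 :> R.
  rewrite mulrC ler_pdivrMr // mul1r ler_nat (leq_trans Jn) //.
  by rewrite (leq_trans _ (ltnW nN)) ?leq_addr.
apply: (@le_trans _ _ (N%:R^-1 * (N.+1%:R * (J%:R / (N + J)%:R) -
    J%:R ^+ r.+1 / n%:R ^+ r - J%:R * ((loss r 2)%:R * eps)))); last first.
  by rewrite ler_pM2l ?invr_gt0 // (le_trans sumge).
rewrite !mulrBr; apply: lerB; last first.
  by rewrite [leLHS]mulrA; apply: ler_piMl => //; rewrite mulr_ge0 ?ler0n.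
apply: lerB.
  rewrite [leRHS]mulrA ler_peMl ?divr_ge0 ?ler0n // mulrC ler_pdivlMr // mul1r ler_nat.
  exact: leqnSn.
have -> : (J%:R / n%:R) ^+ r.+1 = n%:R^-1 * (J%:R ^+ r.+1 / n%:R ^+ r) :> R.
  by rewrite expr_div_n [n%:R ^+ r.+1]exprS invfM mulrCA.
by rewrite ler_wpM2r // divr_ge0 ?exprn_ge0 ?ler0n.
Qed.

(** Three errors of at most [b <= d / 3] each: stopping early, the remainder, and the loss. The
    threshold depends on [d] alone, hence serves all inputs. *)
Lemma cPr_selected_ge_half (R : realType) (d : R) : 0 < d ->
  exists2 eps0 : R, 0 < eps0 & forall (I : input R) (eps : R),
    one_regular I -> (forall f : edge (graph I), xval f <= eps) ->
    eps <= eps0 -> forall e : edge (graph I), 0 < xval e ->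
    2^-1 - d <= cPr (selected e) (active e).
Proof.
move=> d0; pose b : R := Num.min (d / 3) 2^-1.
have b0 : 0 < b by rewrite /b lt_min; apply/andP; split; lra.
have bd : b <= d / 3 by rewrite /b ge_min lexx.
have b2 : b <= 2^-1 by rewrite /b ge_min lexx orbT.
(* The remainder decays only before time 1, so the arrivals in the last
   fraction [b] of the order are discarded. *)
pose z : R := 1 - b / 2.
have z01 : 0 <= z < 1 by apply/andP; split; rewrite /z; lra.
have [r zr] : exists r, z ^+ r.+1 <= b.
  have zn : `|z| < 1 by rewrite ger0_norm; case/andP: z01.
  have /cvgrPdist_le /(_ b b0) [m _ mP] := cvg_geometric 1 zn.
  exists m; have := mP m.+1 (leqnSn m).
  by rewrite /geometric /= mul1r sub0r normrN ger0_norm // exprn_ge0; case/andP: z01.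
set L := (loss r 2)%:R : R; have L0 : 0 <= L by rewrite ler0n.
have r0 : 0 < r.+1%:R :> R by rewrite ltr0n.
(* The first bound gives [L * eps <= b]; the second, with [1 <= N * eps], makes [N] large compared
   with [r]. *)
exists (Num.min (b / (L + 1)) (b / (2 * r.+1%:R))).
  by rewrite lt_min !divr_gt0 ?mulr_gt0 ?ltr_wpDl.
move=> I eps reg xle; rewrite le_min => /andP[epsL epsr] e xe.
have e0 := eps_ge0 xle e; have := card_edges_ge reg xle e.
set N := #|edge (graph I)| => Neps.
have N0 : 0 <= N%:R :> R by rewrite ler0n.
have bN : 2 * r.+1%:R <= b * N%:R.
  have : 1 <= N%:R * (b / (2 * r.+1%:R)).
    by rewrite (le_trans Neps) // ler_wpM2l.
  by rewrite mulrA ler_pdivlMr ?mulr_gt0 // mul1r [b * _]mulrC.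
have Leps : L * eps <= b.
  have : L * eps <= L * (b / (L + 1)) by rewrite ler_wpM2l.
  move/le_trans; apply; rewrite mulrCA; apply: ler_piMr; first exact: ltW.
  by rewrite ler_pdivrMr ?ltr_wpDl // mul1r lerDl.
have bNh : b * N%:R <= N%:R / 2 by rewrite mulrC ler_wpM2l.
have r1 : 1 <= r.+1%:R :> R by rewrite ler1n.
have rN : (r.+1 < N)%N by rewrite -(ltr_nat R); lra.
pose n := (N - r.+1)%N.
have nE : n%:R = N%:R - r.+1%:R :> R by rewrite natrB // ltnW.
have n0 : (0 < n)%N by rewrite subn_gt0.
have n0' : 0 < n%:R :> R by rewrite ltr0n.
pose J := Num.truncn ((1 - b) * N%:R).
have /andP[Jle Jgt] : J%:R <= (1 - b) * N%:R < J.+1%:R.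
  by apply: truncn_itv; rewrite mulr_ge0 //; lra.
rewrite -natr1 in Jgt.
(* Passing from [N] to [n] costs [r.+1 <= b * N / 2], the slack between the fractions [1 - b] and
   [z]. *)
have Jz : J%:R <= z * n%:R.
  rewrite nE /z; have : 0 <= b * r.+1%:R by rewrite mulr_ge0 // ltW.
  lra.
have Jn : (J <= n)%N.
  rewrite -(ler_nat R) (le_trans Jz) //; apply: ler_piMl; first exact: ltW.
  by case/andP: z01 => _ /ltW.
have := @cPr_selected_ge R I eps r n J e reg xle xe n0.
rewrite -/N -/L => /(_ _ Jn) ge; apply: le_trans (ge _); last first.
  by rewrite /n; move: rN; clear; lia.
have pw : (J%:R / n%:R) ^+ r.+1 <= b.
  apply: le_trans zr; rewrite lerXn2r ?nnegrE ?divr_ge0 ?ler0n //.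
    by case/andP: z01.
  by rewrite ler_pdivrMr.
(* Rounding in [J] is absorbed by [b * N >= 2]. *)
have fr : 2^-1 - b <= J%:R / (N + J)%:R.
  have NJ : 0 < N%:R + J%:R :> R by rewrite ltr_pwDl ?ler0n //; lra.
  have J0 : 0 <= J%:R :> R by rewrite ler0n.
  have bJ : 0 <= b * J%:R by rewrite mulr_ge0 // ltW.
  by rewrite natrD ler_pdivlMr //; lra.
lra.
Qed.

Theorem theorem10 (R : realType) (I : nat -> input R)
  (hreg : forall n, one_regular (I n))
  (hvan : vanishing_edge_values I) :
  exists c : nat -> R, (c @ \oo --> (2^-1 : R))%classic /\
    forall n, random_order_greedy_selectable (I n) (c n).
Proof.
have [eps [eps0 xle]] := hvan.
(* The worst edge, capped at [2^-1]: selectability is immediate, and convergence needs only a lower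
   bound. *)
exists (fun n => \big[Num.min/2^-1]_(e : edge (graph (I n)) | 0 < xval e)
  cPr (selected e) (active e)); split; last first.
  by move=> n e xe; apply: bigmin_le_cond.
apply/cvgrPdist_le => d d0; have [b b0 bP] := cPr_selected_ge_half d0.
move/cvgrPdist_le: eps0 => /(_ b b0); apply: filterS => n.
rewrite sub0r normrN => /(le_trans (ler_norm _)) epsb.
rewrite ger0_norm ?subr_ge0 ?bigmin_le_id // lerBlDr addrC -lerBlDr.
apply: le_bigmin => [|e xe]; first by rewrite gerBl ltW.
exact: bP (hreg n) (xle n) epsb e xe.
Qed.
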